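(* Let $(X;\sim,\backsim,\wedge,1)$ be a pseudo equality algebra in the sense of Jenei and Kóródi (a JK-pseudo equality algebra). Then $a\sim b=a\backsim b$ for all $a,b\in X$, and $(X;\sim,\wedge,1)$ is an equality algebra. That is, every JK-pseudo equality algebra is an equality algebra.
   Context: In both definitions, $\leq$ is the order of the meet-semilattice: $x\le y$ iff $x\wedge y=x$. An equality algebra is an algebra $(X;\sim,\wedge,1)$ of type $(2,2,0)$ such that for all $a,b,c\in X$: (E1) $(X;\wedge,1)$ is a meet-semilattice with top element $1$; (E2) $a\sim b=b\sim a$; (E3) $a\sim a=1$; (E4) $a\sim 1=a$; (E5) $a\leq b\leq c$ implies $a\sim c\leq b\sim c$ and $a\sim c\leq a\sim b$; (E6) $a\sim b\leq (a\wedge c)\sim (b\wedge c)$; (E7) $a\sim b\leq (a\sim c)\sim (b\sim c)$. A JK-pseudo equality algebra is an algebra $(X;\sim,\backsim,\wedge,1)$ of type $(2,2,2,0)$ such that for all $a,b,c\in X$: (F1') $(X;\wedge,1)$ is a meet-semilattice with top element $1$; (F2') $a\sim b=b\sim a$ and $a\backsim b=b\backsim a$; (F3') $a\sim a=1=a\backsim a$; (F4') $a\sim 1=a=a\backsim 1$; (F5') $a\leq b\leq c$ implies $a\sim c\leq b\sim c$, $a\sim c\leq a\sim b$, $c\backsim a\leq c\backsim b$ and $c\backsim a\leq b\backsim a$; (F6') $a\sim b\leq (a\wedge c)\sim (b\wedge c)$ and $a\backsim b\leq (a\wedge c)\backsim (b\wedge c)$; (F7') $a\sim b\leq (a\sim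 c)\backsim (b\sim c)$ and $a\backsim b\leq (a\backsim c)\sim (b\backsim c)$. *)

(* Defs.v *)
From mathcomp Require Import ssreflect ssrfun ssrbool.

Set Implicit Arguments.
Unset Strict Implicit.
Unset Printing Implicit Defensive.

(* Carriers are arbitrary types and [=] is Leibniz equality: the library's
   [tMeetSemilatticeType] is not used because it would also require the carrier
   to be a [choiceType]. *)

Record is_top_meet_semilattice (X : Type) (meet : X -> X -> X) (one : X) : Prop
  := TopMeetSemilattice {
  tms_assoc : associative meet;
  tms_comm : commutative meet;
  tms_idem : idempotent_op meet;
  tms_top : right_id one meet
}.

Definition meet_le (X : Type) (meet : X -> X -> X) (x y : X) : Prop :=
  meet x y = x.

Record is_equality_algebra (X : Type) (sim meet : X -> X -> X) (one : X) : Prop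
  := EqualityAlgebra {
  E1 : is_top_meet_semilattice meet one;
  E2 : forall a b, sim a b = sim b a;
  E3 : forall a, sim a a = one;
  E4 : forall a, sim a one = a;
  E5 : forall a b c, meet_le meet a b -> meet_le meet b c ->
         meet_le meet (sim a c) (sim b c) /\
         meet_le meet (sim a c) (sim a b);
  E6 : forall a b c,
         meet_le meet (sim a b) (sim (meet a c) (meet b c));
  E7 : forall a b c,
         meet_le meet (sim a b) (sim (sim a c) (sim b c))
}.

(* [sim] and [bsim] are the operations written \sim and \backsim. *)
Record is_JK_pseudo_equality_algebra
    (X : Type) (sim bsim meet : X -> X -> X) (one : X) : Prop
  := JKPseudoEqualityAlgebra {
  F1 : is_top_meet_semilattice meet one;
  F2 : forall a b, sim a b = sim b a /\ bsim a b = bsim b a;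
  F3 : forall a, sim a a = one /\ one = bsim a a;
  F4 : forall a, sim a one = a /\ a = bsim a one;
  F5 : forall a b c, meet_le meet a b -> meet_le meet b c ->
         [/\ meet_le meet (sim a c) (sim b c),
             meet_le meet (sim a c) (sim a b),
             meet_le meet (bsim c a) (bsim c b)
           & meet_le meet (bsim c a) (bsim b a)];
  F6 : forall a b c,
         meet_le meet (sim a b) (sim (meet a c) (meet b c)) /\
         meet_le meet (bsim a b) (bsim (meet a c) (meet b c));
  F7 : forall a b c,
         meet_le meet (sim a b) (bsim (sim a c) (sim b c)) /\
         meet_le meet (bsim a b) (sim (bsim a c) (bsim b c))
}.

(* Main.v *)
Require Import Defs.
From mathcomp Require Import ssreflect ssrfun ssrbool.

(** Putting c = 1 in the mixed axiom F7 turns the right-hand sides into the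
    other operation at (a, b), because 1 is neutral for both operations (F4).
    So each operation lies below the other, and they agree by antisymmetry of
    the meet order; each equality algebra axiom is then the corresponding
    axiom F1-F7 for the first operation, with F7 rewritten along the
    agreement. *)

Lemma meet_le_antisym (X : Type) (meet : X -> X -> X) (x y : X) :
  commutative meet -> meet_le meet x y -> meet_le meet y x -> x = y.
Proof. by move=> meetC; rewrite /meet_le meetC => ->. Qed.

Theorem mainTheorem1 (X : Type) (sim bsim meet : X -> X -> X) (one : X)
    (HX : is_JK_pseudo_equality_algebra sim bsim meet one) :
  (forall a b : X, sim a b = bsim a b) /\ is_equality_algebra sim meet one.
Proof.
case: HX => semilattice simC simxx simx1 sim_mono sim_meet sim_sim.
have sim_bsim a b : sim a b = bsim a b.
  have [sima1 bsima1] := simx1 a; have [simb1 bsimb1] := simx1 b.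
  have [le_sim_bsim le_bsim_sim] := sim_sim a b one.
  apply: (meet_le_antisym _ _ _ _ (tms_comm semilattice)).
    by rewrite sima1 simb1 in le_sim_bsim.
  by rewrite -bsima1 -bsimb1 in le_bsim_sim.
split=> //; split=> //.
- by move=> a b; case: (simC a b).
- by move=> a; case: (simxx a).
- by move=> a; case: (simx1 a).
- by move=> a b c le_ab le_bc; case: (sim_mono a b c le_ab le_bc).
- by move=> a b c; case: (sim_meet a b c).
by move=> a b c; rewrite (sim_bsim (sim a c)); case: (sim_sim a b c).
Qed.
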